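(* Let $C$ be a normal cone with nonempty interior $\operatorname{int}C$ in a real Banach space $(X,\|\cdot\|)$, let $\psi\in C^*\setminus\{0\}$, and $\Sigma=\{x\in\operatorname{int}C\mid\psi(x)=1\}$. Let $G$ be an open subset of $(X,\|\cdot\|)$ included in $C$ and let $f:G\to\operatorname{int}C$ be a map such that $f|_{G\cap\Sigma}$ is nonexpansive with respect to Hilbert's projective metric $d$ (i.e. $d(f(x),f(y))\le d(x,y)$ for all $x,y\in G\cap\Sigma$). Assume that $v\in G\cap\Sigma$ is a fixed point of $f$: $f(v)=v$. Assume: (A1) $f$ is semidifferentiable at $v$, with semidifferential $f'_v:X\to X$; (A2) the map $(\mathrm{Id}-f'_v)|_{\psi^{-1}(0)}:\psi^{-1}(0)\to X$ has Property (F); (A3) the fixed point of $f'_v$ in $\psi^{-1}(0)$ is unique: if $x\in\psi^{-1}(0)$ and $f'_v(x)=x$, then $x=0$; (A4) $f'_v$ is order preserving: $x\le y$ implies $f'_v(x)\le f'_v(y)$; (A5) $f'_v$ is additively subhomogeneous with respect to $v$: $f'_v(x+tv)\le f'_v(x)+tv$ for all $x\in X$ and $t\ge0$. Then the eigenvector of $f$ in $G\cap\Sigma$ is unique: if $w\in G\cap\Sigma$ and $f(w)=\lambda w$ for some $\lambda>0$, then $w=v$.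
   Context: Cones: a subset $C\subset X$ is a cone if $tC\subset C$ for all $t\ge0$. It is proper if it is closed, convex and pointed ($C\cap(-C)=\{0\}$); it then defines the partial order $x\le y\iff y-x\in C$. It is normal if it is proper and there is a constant $M$ with $\|x\|\le M\|y\|$ whenever $0\le x\le y$. $C^*$ is the set of continuous linear forms $\psi$ on $X$ with $\psi(x)\ge0$ for all $x\in C$. Hilbert's projective metric: for $x,y\in\operatorname{int}C$, let $M(y/x)=\inf\{b\in\mathbb R\mid y\le bx\}$ and $m(y/x)=\sup\{a\in\mathbb R\mid ax\le y\}$; then $d(x,y)=\log M(y/x)-\log m(y/x)$. Semidifferentiability: let $G\subset X$ and $v$ an interior point of $G$. A map $f:G\to X$ is semidifferentiable at $v$ if there exists a continuous, positively homogeneous map $h:X\to X$ (i.e. $h(tx)=th(x)$ for all $t>0$, $x\in X$) such that $f(v+x)=f(v)+h(x)+o(\|x\|)$ as $x\to0$. Such $h$ is unique and denoted $f'_v$ (the semidifferential of $f$ at $v$). Property (F): a map $g:D\to Y$, with $D\subset X$ and $X,Y$ Banach spaces, has Property (F) if every sequence $(x_j)_{j\ge1}$ in $D$ that is bounded in $X$ and satisfies $g(x_j)\to0$ has a subsequence that converges in $X$. *)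

(* Defs.v *)
From HB Require Import structures.
From mathcomp Require Import all_boot all_order all_algebra.
From mathcomp Require Import all_classical all_reals all_analysis.

Set Implicit Arguments.
Unset Strict Implicit.
Unset Printing Implicit Defensive.

Import Order.TTheory GRing.Theory Num.Theory.
Import numFieldNormedType.Exports.

Local Open Scope classical_set_scope.
Local Open Scope ring_scope.

Section cones.
Context {R : realType} {X : completeNormedModType R}.
Implicit Types (C : set X) (x y : X).

Definition is_cone C : Prop :=
  forall (t : R) x, 0 <= t -> C x -> C (t *: x).

Definition proper_cone C : Prop :=
  [/\ is_cone C, closed C, convex_set (C : set (convex_lmodType X))
    & C `&` (-%R @` C) = [set 0]].

Definition cone_le C x y : Prop := C (y - x).

Definition normal_cone C : Prop :=
  proper_cone C /\
  exists M : R, forall x y, cone_le C 0 x -> cone_le C x y -> `|x| <= M * `|y|.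

Definition dual_cone C : set {linear X -> R^o} :=
  [set psi | continuous psi /\ forall x, C x -> 0 <= (psi x : R)].

Definition cone_slice C (psi : {linear X -> R^o}) : set X :=
  [set x | interior C x /\ psi x = 1].

(* The infimum and supremum are those of real numbers (with junk value 0 for
   unbounded or empty sets); for a proper cone [C] of a nonzero space and
   [x], [y] in its interior they are genuine and positive. *)
Definition cone_M C y x : R := inf [set b : R | cone_le C y (b *: x)].

Definition cone_m C y x : R := sup [set a : R | cone_le C (a *: x) y].

Definition hilbert_metric C x y : R := ln (cone_M C y x) - ln (cone_m C y x).

End cones.

(* [f] is total, but as [v] is interior to [G] only the restriction of [f] to
   [G] matters.  By the uniqueness lemma below, [h] is the
   semidifferential f'_v. *)
Definition is_semidifferential {R : realType} {X : completeNormedModType R}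
    (G : set X) (f : X -> X) (v : X) (h : X -> X) : Prop :=
  [/\ interior G v,
      continuous h,
      (forall (t : R) x, 0 < t -> h (t *: x) = t *: h x)
    & f \o shift v = cst (f v) + h +o_ (0 : X) (@idfun X)].

Lemma is_semidifferential_unique {R : realType} {X : completeNormedModType R}
    (G : set X) (f : X -> X) (v : X) (h k : X -> X) :
  is_semidifferential G f v h -> is_semidifferential G f v k -> h = k.
Proof.
move=> [_ _ hZ fh] [_ _ kZ fk]; apply/funext => x.
apply/eqP; rewrite -subr_eq0 -normr_le0; apply/ler_addgt0Pl => e e0.
rewrite addr0.
have [->|x0] := eqVneq x 0.
  have z0 (g : X -> X) : (forall (t : R) x, 0 < t -> g (t *: x) = t *: g x) ->
      g 0 = 0.
    move=> gZ; have := gZ 2 0 (ltr0Sn _ _); rewrite scaler0.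
    by rewrite scaler_nat mulr2n -{1}[g 0]addr0 => /addrI.
  by rewrite (z0 h hZ) (z0 k kZ) subrr normr0 ltW.
have nx0 : 0 < `|x| by rewrite normr_gt0.
pose d := e / 2 / `|x|.
have d0 : 0 < d by rewrite !divr_gt0.
move/eqaddoP : fh => /(_ d d0) fh; move/eqaddoP : fk => /(_ d d0) fk.
have /nbhs_ballP[r /= r0 rP] : \forall y \near (0 : X),
    `|h y - k y| <= (d + d) * `|y|.
  near=> y.
  have yh : `|(f \o shift v - (cst (f v) + h)) y| <= d * `|y| by near: y.
  have yk : `|(f \o shift v - (cst (f v) + k)) y| <= d * `|y| by near: y.
  rewrite mulrDl; apply: le_trans (lerD yk yh).
  apply: le_trans (ler_normB _ _).
  have -> (a b p q : X) : (a - (b + q)) - (a - (b + p)) = p - q.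
    by rewrite opprB addrC addrA subrK opprD addrACA subrr add0r.
  by [].
pose t := r / 2 / `|x|.
have t0 : 0 < t by rewrite !divr_gt0.
have /rP : ball (0 : X) r (t *: x).
  rewrite -ball_normE /= sub0r normrN normrZ gtr0_norm// divfK ?gt_eqF//.
  by rewrite ltr_pdivrMr// ltr_pMr// ltr1n.
rewrite /= (hZ _ _ t0) (kZ _ _ t0) -scalerBr (normrZ t x) (normrZ t (h x - k x)).
rewrite (gtr0_norm t0) mulrCA ler_pM2l//.
by move=> /le_trans; apply; rewrite -mulrDl -splitr divfK ?gt_eqF.
Unshelve. all: by end_near. Qed.

Definition property_F {R : realType} {X Y : completeNormedModType R}
    (D : set X) (g : X -> Y) : Prop :=
  forall u : nat -> X,
    (forall n, D (u n)) -> bounded_set (range u) ->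
    g \o u @ \oo --> (0 : Y) ->
    exists2 phi : nat -> nat, increasing_seq phi &
      cvg (u \o phi @ \oo).

(* Main.v *)
Require Import Defs.
From mathcomp Require Import all_boot all_order all_algebra.
From mathcomp Require Import all_classical all_reals all_analysis.
From mathcomp Require Import ring lra.
Import Order.TTheory GRing.Theory Num.Theory.
Import numFieldNormedType.Exports.
Local Open Scope classical_set_scope.
Local Open Scope ring_scope.

(* Let g = f / psi(f), so that v and w are fixed points of g. Suppose w <> v.
   Segments are geodesics for Hilbert's metric d, so for a point z0 of the
   segment from v to w close to v, the set K of the z in Sigma with
   d(v, z) <= d(v, z0) and d(w, z) <= d(w, z0) contains z0; it is convex,
   invariant under g, close to v and, by the triangle inequality, away from v.
   Each map z |-> (1 - t) g(z) + t z0 contracts e^d - 1 on K, so g has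
   approximate fixed points in K. Taking z0 close to v and rescaling z - v
   gives unit vectors x in ker psi and reals a with x - f'_v(x) + a v -> 0.
   (A4) and (A5) force a -> 0: if x <= t v with t least, then
   x + a v <= t v + o(1), hence a <= o(1), and symmetrically for -a. By (A2)
   a subsequence of x converges to a unit vector contradicting (A3). *)

Set Implicit Arguments.
Unset Strict Implicit.

(** * Closed sets of reals, positively homogeneous maps and coercivity *)

Lemma closed_sup (R : realType) (A : set R) : closed A -> has_sup A -> A (sup A).
Proof. by move=> clA [A0 ubA]; apply/clA/closure_sup. Qed.

Lemma closed_inf (R : realType) (A : set R) : closed A -> has_inf A -> A (inf A).
Proof.
move=> clA /has_inf_supN sA; have : (-%R @^-1` A) (sup (-%R @` A)).
  have eA : -%R @` A = -%R @^-1` A.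
    apply/seteqP; split=> [_ [x Ax <-]|x Ax] /=; first by rewrite opprK.
    by exists (- x); rewrite ?opprK.
  rewrite -{1}eA; apply: closed_sup => //.
  rewrite eA; apply: preimage_closed => // x _; exact: opp_continuous.
by [].
Qed.

Lemma homogeneous0 (R : realType) (U V : normedModType R) (h : U -> V) :
  (forall (t : R) x, 0 < t -> h (t *: x) = t *: h x) -> h 0 = 0.
Proof.
move=> hZ; have := hZ 2 0 (ltr0Sn _ _); rewrite scaler0.
by rewrite scaler_nat mulr2n -{1}[h 0]addr0 => /addrI.
Qed.

(** Continuity at [0] bounds [h] by [1] on a ball of radius [e]; rescaling [x] to norm [e / 2] gives
    the constant [2 / e]. *)
Lemma homogeneous_bounded (R : realType) (U V : normedModType R) (h : U -> V) :
  (forall (t : R) x, 0 < t -> h (t *: x) = t *: h x) -> h 0 = 0 ->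
  {for 0, continuous h} -> exists2 K : R, 0 < K & forall x, `|h x| <= K * `|x|.
Proof.
move=> hZ h0 /cvgrPdist_le /(_ 1 ltr01); rewrite h0.
move=> /nbhs_ballP[e /= e0 eP]; exists (2 / e); first exact: divr_gt0.
move=> x; have [->|x0] := eqVneq x 0; first by rewrite h0 !normr0 mulr0.
have nx0 : 0 < `|x| by rewrite normr_gt0.
have t0 : 0 < e / 2 / `|x| by rewrite !divr_gt0.
have /eP : ball (0 : U) e ((e / 2 / `|x|) *: x).
  rewrite -ball_normE /= sub0r normrN normrZ gtr0_norm// divfK ?gt_eqF//.
  lra.
rewrite /= sub0r normrN hZ // normrZ gtr0_norm // => le1.
move: le1; rewrite -ler_pdivlMl // mulr1 => /le_trans; apply.
by rewrite le_eqVlt; apply/orP; left; apply/eqP; field; rewrite !gt_eqF.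
Qed.

Lemma exists_expr_mul_le (R : realType) (q a e : R) :
  0 <= q < 1 -> 0 < e -> exists n, q ^+ n * a <= e.
Proof.
move=> /andP[q0 q1] e0.
have : (fun n => q ^+ n * a) @ \oo --> (0 * a : R).
  by apply: cvgM; [apply: cvg_expr; rewrite ger0_norm|exact: cvg_cst].
rewrite mul0r => /cvgrPdist_le /(_ e e0)[n _ /(_ n (leqnn n))] /=.
rewrite sub0r normrN => le; exists n; exact: le_trans (ler_norm _) le.
Qed.

Lemma increasing_seq_ge_id (phi : nat -> nat) : increasing_seq phi ->
  forall n, (n <= phi n)%N.
Proof.
move=> /increasing_seqP phiS; elim=> // n IHn.
exact: leq_ltn_trans (phiS n).
Qed.

(** Quantitative form of (A2) and (A3): without such a [c], unit vectors [u n] of the kernel with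
    [u n - h (u n) -> 0] would have a subsequence converging to a unit fixed point of [h]. *)
Lemma property_F_coercive (R : realType) (X : completeNormedModType R)
    (psi : {linear X -> R^o}) (h : X -> X) :
  continuous psi -> continuous h ->
  (forall (t : R) x, 0 < t -> h (t *: x) = t *: h x) ->
  property_F (psi @^-1` [set 0]) (fun x => x - h x) ->
  (forall x, psi x = 0 -> h x = x -> x = 0) ->
  exists2 c : R, 0 < c & forall x, psi x = 0 -> c * `|x| <= `|x - h x|.
Proof.
move=> psic hc hZ hF huniq; apply: contrapT => nc.
have /choice[u uP] n : exists x : X,
    [/\ psi x = 0, `|x| = 1 & `|x - h x| <= n.+1%:R^-1].
  apply: contrapT => nx; apply: nc; exists n.+1%:R^-1; first by rewrite invr_gt0.
  move=> x x0; rewrite leNgt; apply/negP => lt1; apply: nx.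
  have nx0 : 0 < `|x|.
    by rewrite normr_gt0; apply/eqP => x00; move: lt1;
       rewrite x00 normr0 mulr0 normr_lt0.
  have i0 : 0 < `|x|^-1 by rewrite invr_gt0.
  exists (`|x|^-1 *: x); split.
  - by rewrite linearZ /= x0 scaler0.
  - by rewrite normrZ gtr0_norm // mulVf // gt_eqF.
  - by rewrite hZ // -scalerBr normrZ gtr0_norm // ler_pdivrMl // mulrC ltW.
have small : (fun x => x - h x) \o u @ \oo --> (0 : X).
  apply/norm_cvg0P; apply: (@squeeze_cvgr _ _ _ _ (cst 0) (@harmonic R)).
  - by near=> n; rewrite /= normr_ge0 /=; have [_ _] := uP n.
  - exact: cvg_cst.
  - exact: cvg_harmonic.
have bounded : bounded_set (range u).
  exists 1; split => // M M1 _ [n _ <-] /=.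
  by have [_ -> _] := uP n; exact: ltW.
have [phi phi_incr /cvg_ex[l ul]] := hF u (fun n => let: And3 p _ _ := uP n in p)
  bounded small.
have psil : psi l = 0.
  have := cvg_comp _ _ ul (psic l) => psiul.
  have : psi \o (u \o phi) @ \oo --> (0 : R^o).
    rewrite (_ : psi \o _ = cst 0); first exact: cvg_cst.
    by apply/funext => n /=; have [->] := uP (phi n).
  by move=> /(cvg_unique _ psiul) ->.
have norml : `|l| = 1.
  have nul : (fun n => `|(u \o phi) n|) @ \oo --> `|l| by exact: cvg_norm ul.
  have : (fun n => `|(u \o phi) n|) @ \oo --> (1 : R).
    rewrite (_ : (fun n => _) = cst 1); first exact: cvg_cst.
    by apply/funext => n /=; have [_ ->] := uP (phi n).
  by move=> /(cvg_unique _ nul) ->.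
have hl : l - h l = 0.
  have hul : (fun n => (u \o phi) n - h ((u \o phi) n)) @ \oo --> l - h l.
    by apply: (cvgB ul); exact: (cvg_comp _ _ ul (hc l)).
  have : (fun n => (u \o phi) n - h ((u \o phi) n)) @ \oo --> (0 : X).
    apply/norm_cvg0P; apply: (@squeeze_cvgr _ _ _ _ (cst 0) (@harmonic R)).
    - near=> n; rewrite /= normr_ge0 /=; have [_ _ le] := uP (phi n).
      apply: (le_trans le); rewrite lef_pV2 ?posrE // ler_nat ltnS.
      exact: increasing_seq_ge_id.
    - exact: cvg_cst.
    - exact: cvg_harmonic.
  by move=> hul0; apply: (cvg_unique _ hul hul0); exact: norm_hausdorff.
have l0 : l = 0 by apply: huniq => //; apply/esym/eqP; rewrite -subr_eq0 hl.
by move: norml; rewrite l0 normr0 => /eqP; rewrite eq_sym oner_eq0.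
Unshelve. all: by end_near. Qed.

(** * Vector identities by comparison of coefficients *)

Section linear_combinations.
Context {R : realType} {V : lmodType R}.
Implicit Types (p : V * V * V * V).

Definition lincomb p (a b c d : R) : V :=
  a *: p.1.1.1 + b *: p.1.1.2 + c *: p.1.2 + d *: p.2.

Lemma lincombD p a b c d a' b' c' d' :
  lincomb p a b c d + lincomb p a' b' c' d' =
  lincomb p (a + a') (b + b') (c + c') (d + d').
Proof.
rewrite /lincomb !scalerDl addrACA; congr (_ + _).
by rewrite addrACA; congr (_ + _); rewrite addrACA.
Qed.

Lemma lincombN p a b c d :
  - lincomb p a b c d = lincomb p (- a) (- b) (- c) (- d).
Proof. by rewrite /lincomb !opprD !scaleNr. Qed.

Lemma lincombZ p k a b c d :
  k *: lincomb p a b c d = lincomb p (k * a) (k * b) (k * c) (k * d).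
Proof. by rewrite /lincomb !scalerDr !scalerA. Qed.

(** The existential keeps [p] opaque, so that rewritten atoms do not reappear inside the tuple and
    only coefficients remain to be compared. *)
Lemma lincomb_atoms x y z w : exists p,
  [/\ x = lincomb p 1 0 0 0, y = lincomb p 0 1 0 0,
      z = lincomb p 0 0 1 0 & w = lincomb p 0 0 0 1].
Proof.
exists (x, y, z, w).
by rewrite /lincomb /= !scale1r !scale0r !addr0 !add0r.
Qed.

End linear_combinations.

(* Reduces a vector identity that is linear in at most four atoms to [field];
   unused slots are filled by repeating an atom. *)
Ltac lincomb_field x y z w :=
  let p := fresh "p" in
  let Ex := fresh "Ex" in let Ey := fresh "Ey" in
  let Ez := fresh "Ez" in let Ew := fresh "Ew" in
  have [p [Ex Ey Ez Ew]] := lincomb_atoms x y z w;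
  rewrite ?Ex ?Ey ?Ez ?Ew {Ex Ey Ez Ew} ?(lincombN, lincombZ, lincombD);
  congr (lincomb _ _ _ _ _); field.

(** That is, [a x <= y <= r a x]: the bound [d (x, y) <= ln r] of [hilbert_metric_le], in a form
    free of logarithms and extrema, in which inequalities can be added and scaled. *)
Definition ratio_le {R : realType} {X : completeNormedModType R} (C : set X)
    (x y : X) (r : R) : Prop :=
  exists a : R, [/\ 0 < a, C (y - a *: x) & C ((r * a) *: x - y)].

(** * The cone order and the calculus of [ratio_le] *)

Section cone_order.
Context {R : realType} {X : completeNormedModType R} {C : set X}.
Hypothesis coneC : is_cone C.
Hypothesis convexC : convex_set (C : set (convex_lmodType X)).

Lemma coneD x y : C x -> C y -> C (x + y).
Proof.
move=> Cx Cy.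
have h0 : 0 <= 2^-1 :> R by lra.
have h1 : 2^-1 <= 1 :> R by lra.
have /set_mem := @convexC x y (Itv01 h0 h1) (mem_set Cx) (mem_set Cy).
move=> /(@coneC 2 _ (ler0n _ _)); rewrite /conv /=.
by rewrite /unstable.onem; congr (C _); lincomb_field x y x y.
Qed.

(** Common format of the order arguments: a vector is exhibited as a nonnegative combination of two
    members of [C], and the identity is left to computation. *)
Lemma cone_lincomb a b x y u :
  0 <= a -> 0 <= b -> C x -> C y -> u = a *: x + b *: y -> C u.
Proof. by move=> a0 b0 Cx Cy ->; apply: coneD; apply: coneC. Qed.

Lemma ratio_le_sym x y r : 0 < r -> ratio_le C x y r -> ratio_le C y x r.
Proof.
move=> r0 [a [a0 lb ub]]; exists (r * a)^-1; split.
- by rewrite invr_gt0 mulr_gt0.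
- apply: (@cone_lincomb (r * a)^-1 0 _ _ _ _ _ ub ub) => //.
    by rewrite invr_ge0 ltW ?mulr_gt0.
  by lincomb_field x y x y; rewrite ?gt_eqF.
- apply: (@cone_lincomb a^-1 0 _ _ _ _ _ lb lb) => //.
    by rewrite invr_ge0 ltW.
  by lincomb_field x y x y; rewrite ?gt_eqF.
Qed.

(** Triangle inequality for [d]: the lower multipliers multiply. *)
Lemma ratio_le_trans x y z r s : 0 <= s ->
  ratio_le C x y r -> ratio_le C y z s -> ratio_le C x z (r * s).
Proof.
move=> s0 [a [a0 lb ub]] [b [b0 lb' ub']]; exists (a * b); split.
- exact: mulr_gt0.
- apply: (@cone_lincomb 1 b _ _ _ _ _ lb' lb) => //; first exact: ltW.
  by lincomb_field x y z x.
- apply: (@cone_lincomb 1 (s * b) _ _ _ _ _ ub' ub) => //.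
    by rewrite mulr_ge0 // ltW.
  by lincomb_field x y z x.
Qed.

Lemma ratio_leZr x y (r k : R) :
  0 < k -> ratio_le C x y r -> ratio_le C x (k *: y) r.
Proof.
move=> k0 [a [a0 lb ub]]; exists (k * a); split; first exact: mulr_gt0.
- apply: (@cone_lincomb k 0 _ _ _ _ _ lb lb) => //; first exact: ltW.
  by lincomb_field x y x y.
- apply: (@cone_lincomb k 0 _ _ _ _ _ ub ub) => //; first exact: ltW.
  by lincomb_field x y x y.
Qed.

Lemma ratio_leZl x y (r k : R) :
  0 < k -> ratio_le C x y r -> ratio_le C (k *: x) y r.
Proof.
move=> k0 [a [a0 lb ub]]; exists (a / k); split; first exact: divr_gt0.
- by rewrite scalerA divfK ?gt_eqF.
- by rewrite scalerA mulrA divfK ?gt_eqF.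
Qed.

(** Balls of [d] are convex: averaging the inequalities for [y] and [z] averages the multipliers and
    keeps the ratio [r]. *)
Lemma ratio_le_convex x y z r t : 0 <= t <= 1 ->
  ratio_le C x y r -> ratio_le C x z r -> ratio_le C x ((1 - t) *: y + t *: z) r.
Proof.
move=> /andP[t0 t1] [a [a0 lb ub]] [b [b0 lb' ub']].
have u0 : 0 <= 1 - t by lra.
exists ((1 - t) * a + t * b); split.
- by nra.
- apply: (@cone_lincomb (1 - t) t _ _ _ _ _ lb lb') => //.
  by lincomb_field x y z x.
- apply: (@cone_lincomb (1 - t) t _ _ _ _ _ ub ub') => //.
  by lincomb_field x y z x.
Qed.

(** * Multipliers normalized by a positive linear form *)

Section positive_form.
Context {psi : {linear X -> R^o}}.
Hypothesis psi_ge0 : forall x, C x -> 0 <= (psi x : R).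

Lemma cone_psi_le a b x y : C (a *: x - b *: y) -> b * psi y <= a * psi x.
Proof.
move=> /psi_ge0; have -> : psi (a *: x - b *: y) = a * psi x - b * psi y :> R.
  by rewrite linearB !linearZ.
by rewrite subr_ge0.
Qed.

Lemma ratio_le_psi x y r a : psi x = 1 -> psi y = 1 ->
  C (y - a *: x) -> C ((r * a) *: x - y) -> a <= 1 /\ 1 <= r * a.
Proof.
move=> x1 y1 lb ub; split.
  by move: lb; rewrite -[y]scale1r => /cone_psi_le; rewrite x1 y1; lra.
by move: ub; rewrite -[y]scale1r => /cone_psi_le; rewrite x1 y1; lra.
Qed.

(* With multipliers [a <= 1 <= r * a] for [(x, y)], the averaged pair has
   multipliers [1 - q * (1 - a)] and [1 + q * (r * a - 1)]. *)
Lemma ratio_le_average x y z (r k t : R) :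
  psi x = 1 -> psi y = 1 -> C x -> C z -> 0 <= k -> 0 < t < 1 -> 1 <= r ->
  C (z - k *: x) -> ratio_le C x y r ->
  ratio_le C ((1 - t) *: x + t *: z) ((1 - t) *: y + t *: z)
           (1 + (1 - t) / (1 - t + t * k) * (r - 1)).
Proof.
move=> x1 y1 Cx Cz k0 /andP[t0 t1] r1 zk [a [a0 lb ub]].
have [a1 ra1] := ratio_le_psi x1 y1 lb ub.
have t'0 : 0 < 1 - t by lra.
have tk0 : 0 <= t * k by rewrite mulr_ge0 // ltW.
set d := 1 - t + t * k; have d0 : 0 < d by rewrite /d; lra.
(* With [x'] and [y'] the averaged points, [q] makes the coefficient of [x] vanish when [b' x' - y']
   is expanded on [r a x - y] and [z - k x]; likewise for [y' - a' x']. *)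
set q := (1 - t) / d.
have qd : q * d = 1 - t by rewrite divfK ?gt_eqF.
have q0 : 0 < q by rewrite divr_gt0.
have q1 : q <= 1 by rewrite ler_pdivrMr // mul1r /d; lra.
clearbody q.
pose a' := 1 - q * (1 - a); pose b' := 1 + q * (r * a - 1).
have a'0 : 0 < a' by rewrite /a'; nra.
have Cx' : C ((1 - t) *: x + t *: z).
  by apply: (@cone_lincomb (1 - t) t _ _ _ _ _ Cx Cz) => //; exact: ltW.
have ub' : C (b' *: ((1 - t) *: x + t *: z) - ((1 - t) *: y + t *: z)).
  apply: (@cone_lincomb (1 - t) (t * (b' - 1)) _ _ _ _ _ ub zk).
  - exact: ltW.
  - by rewrite mulr_ge0 ?(ltW t0) // /b' addrC addKr mulr_ge0 ?(ltW q0) ?subr_ge0.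
  - have e : (b' - 1) * d = (1 - t) * (r * a - 1).
      by rewrite /b' -qd; ring.
    have {}e : b' * (1 - t) = (1 - t) * (r * a) - t * (b' - 1) * k.
      by move: e; rewrite /d; lra.
    have [p [-> -> -> _]] := lincomb_atoms x y z x.
    rewrite !(lincombN, lincombZ, lincombD).
    by congr (lincomb _ _ _ _ _); lra.
exists a'; split=> //.
- apply: (@cone_lincomb (1 - t) (t * (1 - a')) _ _ _ _ _ lb zk).
  - exact: ltW.
  - by rewrite mulr_ge0 ?(ltW t0) // /a' subKr mulr_ge0 ?(ltW q0) ?subr_ge0.
  - have e : (1 - a') * d = (1 - t) * (1 - a).
      by rewrite /a' -qd; ring.
    have {}e : a' * (1 - t) = (1 - t) * a + t * (1 - a') * k.
      by move: e; rewrite /d; lra.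
    have [p [-> -> -> _]] := lincomb_atoms x y z x.
    rewrite !(lincombN, lincombZ, lincombD).
    by congr (lincomb _ _ _ _ _); lra.
(* [c] is the slack by which the claimed ratio times [a'] exceeds [b']; it is filled with a multiple
   of the averaged [x]. *)
- pose c := (1 + q * (r - 1)) * a' - b'.
  apply: (@cone_lincomb 1 c _ _ _ _ _ ub' Cx') => //.
    have -> : c = q * (1 - q) * (1 - a) * (r - 1)
      by rewrite /c /a' /b'; ring.
    by rewrite !mulr_ge0 ?(ltW q0) ?subr_ge0.
  have -> : (1 + q * (r - 1)) * a' = b' + c by rewrite /c; ring.
  by rewrite scale1r (scalerDl _ b' c) addrAC.
Qed.

End positive_form.
End cone_order.

(** * Interior points as order units, and Hilbert's metric in terms of [ratio_le] *)

Section order_unit.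
Context {R : realType} {X : completeNormedModType R} {C : set X}.
Hypothesis coneC : is_cone C.
Hypothesis convexC : convex_set (C : set (convex_lmodType X)).

Lemma interior_order_unit x : interior C x ->
  exists2 K : R, 0 < K & forall u, C ((K * `|u|) *: x - u).
Proof.
move=> /nbhs_ballP[e /= e0 eC].
have Cx : C x by apply: eC; exact: ballxx.
exists (2 / e); first exact: divr_gt0.
move=> u; have [->|u0] := eqVneq u 0.
  by rewrite normr0 mulr0 scale0r subr0 -(scale0r x); exact: coneC.
have nu0 : 0 < `|u| by rewrite normr_gt0.
have t0 : 0 < e / 2 / `|u| by rewrite !divr_gt0.
have : C (x - (e / 2 / `|u|) *: u).
  apply: eC; rewrite -ball_normE /= opprB addrC subrK normrZ gtr0_norm//.
  by rewrite divfK ?gt_eqF//; lra.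
have k0 : 0 <= 2 / e * `|u| by rewrite mulr_ge0 // divr_ge0 // ltW.
move=> /(coneC k0); congr (C _); rewrite scalerBr scalerA; congr (_ - _).
by rewrite (_ : _ * _ = 1) ?scale1r //; field; rewrite !gt_eqF.
Qed.

(** For [y] near [x], [y] is the sum of [x - a v], [(a - K |x - y|) v] and [K |x - y| v - (x - y)],
    all in [C]. *)
Lemma interior_ge v x (a : R) : interior C v -> 0 < a -> C (x - a *: v) ->
  interior C x.
Proof.
move=> /interior_order_unit[K K0 Kv] a0 xv.
apply/nbhs_ballP; exists (a / K) => /=; first exact: divr_gt0.
move=> y; rewrite -ball_normE /= => xy.
have Cv : C v.
  have := Kv (- v); rewrite opprK normrN => Cv.
  have Kv1 : 0 < K * `|v| + 1 by rewrite ltr_wpDl // mulr_ge0 // ltW.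
  have /ltW Kv1' : 0 < (K * `|v| + 1)^-1 by rewrite invr_gt0.
  have := coneC Kv1' Cv; congr (C _).
  rewrite (_ : _ + v = (K * `|v| + 1) *: v); last by rewrite scalerDl scale1r.
  by rewrite scalerA mulVf ?scale1r ?gt_eqF.
have aK : 0 <= a - K * `|x - y|.
  by rewrite subr_ge0 ltW // mulrC -ltr_pdivlMr.
have C1 : C (x - a *: v + (a - K * `|x - y|) *: v).
  exact: (coneD coneC convexC xv (coneC aK Cv)).
have := coneD coneC convexC C1 (Kv (x - y)).
congr (C _); set k := K * _.
by lincomb_field x y v x.
Qed.

Context {psi : {linear X -> R^o}}.
Hypothesis psi_ge0 : forall x, C x -> 0 <= (psi x : R).
Hypothesis closedC : closed C.

(** If [psi x = 0], the order unit inequality at [y] and [- y] forces [psi y = 0] for every [y]. *)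
Lemma psi_gt0 x : (exists y, psi y <> 0) -> interior C x -> 0 < (psi x : R).
Proof.
move=> [y y0] Cx; have [K K0 Kx] := interior_order_unit Cx.
rewrite lt_neqAle psi_ge0 ?andbT; last exact: interior_subset.
apply/eqP => x0; apply: y0.
have /(cone_psi_le psi_ge0) : C ((K * `|y|) *: x - 1 *: y) by rewrite scale1r.
rewrite -x0 mulr0 mul1r => le0.
have /(cone_psi_le psi_ge0) : C ((K * `|- y|) *: x - (-1) *: y).
  by rewrite scaleN1r.
rewrite -x0 mulr0 mulN1r oppr_le0 => ge0.
by apply: (@le_anti _ R); rewrite -[psi y]/(psi y : R) le0.
Qed.

Lemma closed_affine_preimage (a b : X) : closed [set t : R | C (t *: a + b)].
Proof.
apply: (@preimage_closed _ _ (fun t : R => t *: a + b) C _ closedC) => t _.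
by apply: cvgD; [exact: scalel_continuous|exact: cvg_cst].
Qed.

Section extremal_multipliers.
Variables x y : X.
Hypotheses (Cx : interior C x) (Cy : interior C y).
Hypothesis x_gt0 : 0 < (psi x : R).

(** [psi] bounds the multipliers by [psi y / psi x], so that [sup], and likewise [inf] below, is not
    a default value. *)
Lemma has_sup_cone_m : has_sup [set a : R | cone_le C (a *: x) y].
Proof.
split.
  exists 0; rewrite /= /cone_le scale0r subr0; exact: interior_subset.
exists (psi y / psi x) => a; rewrite /= /cone_le -{1}(scale1r y).
move=> /(cone_psi_le psi_ge0); rewrite mul1r => ?.
by rewrite ler_pdivlMr.
Qed.

Lemma has_inf_cone_M : has_inf [set b : R | cone_le C y (b *: x)].
Proof.
split.
  by have [K _ Kx] := interior_order_unit Cx; exists (K * `|y|); exact: Kx.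
exists (psi y / psi x) => b; rewrite /= /cone_le -{1}(scale1r y).
move=> /(cone_psi_le psi_ge0); rewrite mul1r => ?.
by rewrite ler_pdivrMr.
Qed.

Lemma cone_mP : C (y - cone_m C y x *: x).
Proof.
apply: (@closed_sup _ [set a : R | C (y - a *: x)]); last exact: has_sup_cone_m.
rewrite (_ : [set a | _] = [set a | C (a *: - x + y)]).
  exact: closed_affine_preimage.
by apply/funext => b; rewrite /= scalerN addrC.
Qed.

Lemma cone_MP : C (cone_M C y x *: x - y).
Proof.
apply: (@closed_inf _ [set b : R | C (b *: x - y)]); last exact: has_inf_cone_M.
exact: closed_affine_preimage.
Qed.

Lemma cone_m_max a : C (y - a *: x) -> a <= cone_m C y x.
Proof. by move=> ?; apply: ub_le_sup => //; case: has_sup_cone_m. Qed.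

Lemma cone_M_min b : C (b *: x - y) -> cone_M C y x <= b.
Proof. by move=> ?; apply: ge_inf => //; case: has_inf_cone_M. Qed.

Lemma cone_m_gt0 : 0 < cone_m C y x.
Proof.
have [K K0 Ky] := interior_order_unit Cy.
have nx0 : 0 < `|x|.
  rewrite normr_gt0; apply/eqP => x0.
  by move: x_gt0; rewrite x0 linear0 ltxx.
have k0 : 0 < (K * `|x|)^-1 by rewrite invr_gt0 mulr_gt0.
apply: (lt_le_trans k0); apply: cone_m_max.
have := coneC (ltW k0) (Ky x); congr (C _).
by rewrite scalerBr scalerA mulVf ?scale1r // gt_eqF // mulr_gt0.
Qed.

Lemma cone_M_gt0 : 0 < cone_M C y x.
Proof.
apply: (lt_le_trans cone_m_gt0); rewrite -(ler_pM2r x_gt0).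
have := coneD coneC convexC cone_mP cone_MP.
rewrite addrC addrA subrK => /(cone_psi_le psi_ge0); exact.
Qed.

Lemma ratio_leP r : 0 < r ->
  ratio_le C x y r <-> cone_M C y x <= r * cone_m C y x.
Proof.
move=> r0; split=> [[a [a0 lb ub]]|Mm].
  apply: (le_trans (cone_M_min ub)).
  by rewrite ler_pM2l //; exact: cone_m_max.
exists (cone_m C y x); split; [exact: cone_m_gt0|exact: cone_mP|].
apply: (cone_lincomb coneC convexC (a := 1) (b := r * cone_m C y x - cone_M C y x)
  _ _ cone_MP (interior_subset Cx)); rewrite ?subr_ge0 //.
set m := cone_m _ _ _; set M := cone_M _ _ _.
by lincomb_field x y x y.
Qed.

(** Both extremal multipliers are positive, so logarithms can be compared. This carries the
    nonexpansiveness of [f] over to [ratio_le]. *)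
Lemma hilbert_metric_le r : 0 < r ->
  hilbert_metric C x y <= ln r <-> ratio_le C x y r.
Proof.
move=> r0; rewrite ratio_leP // /hilbert_metric lerBlDr -lnM ?posrE ?cone_m_gt0 //.
by rewrite ler_ln // ?posrE ?mulr_gt0 ?cone_m_gt0 ?cone_M_gt0.
Qed.

End extremal_multipliers.
End order_unit.

(** * Approximate fixed points of nonexpansive maps on convex sets *)

Section approximate_fixed_points.
Context {R : realType} {X : completeNormedModType R} {C : set X}.
Hypothesis coneC : is_cone C.
Hypothesis convexC : convex_set (C : set (convex_lmodType X)).
Context {N : R}.
Hypothesis N_ge0 : 0 <= N.
Hypothesis normalC :
  forall x y, cone_le C 0 x -> cone_le C x y -> `|x| <= N * `|y|.
Context {psi : {linear X -> R^o}}.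
Hypothesis psi_ge0 : forall x, C x -> 0 <= (psi x : R).

(** Normality turns order bounds into norm bounds. From [a <= 1 <= r a] follows [a + r >= 2], hence
    [(2 - r) x <= y <= r x], so [u] lies between [0] and [2 (r - 1) x]. *)
Lemma ratio_le_dist x y r : C x -> psi x = 1 -> psi y = 1 -> ratio_le C x y r ->
  `|y - x| <= (2 * N + 1) * (r - 1) * `|x|.
Proof.
move=> Cx x1 y1 [a [a0 lb ub]].
have [a1 ra1] := ratio_le_psi psi_ge0 x1 y1 lb ub.
have r1 : 1 <= r by nra.
pose u := y - (2 - r) *: x.
have u0 : cone_le C 0 u.
  apply: (@cone_lincomb _ _ _ coneC convexC 1 (a + r - 2) _ _ _ _ _ lb Cx) => //.
    by nra.
  by rewrite /u subr0; lincomb_field x y x y.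
have u1 : cone_le C u ((2 * (r - 1)) *: x).
  apply: (@cone_lincomb _ _ _ coneC convexC 1 (r * (1 - a)) _ _ _ _ _ ub Cx) => //.
    by apply: mulr_ge0; lra.
  by rewrite /u; lincomb_field x y x y.
have -> : y - x = u - (r - 1) *: x.
  by rewrite /u; lincomb_field x y x y.
have r10 : 0 <= r - 1 by lra.
apply: (le_trans (ler_normB _ _)).
have := normalC u0 u1; rewrite !normrZ !ger0_norm // ?mulr_ge0 //.
by move=> h; lra.
Qed.

(** Converse comparison: the order unit [v] gives [(1 - k) v <= z <= (1 + k) v] with
    [k = K |z - v|]. *)
Lemma dist_ratio_le v z K r : (forall u, C ((K * `|u|) *: v - u)) ->
  C v -> K * `|z - v| < 1 -> 1 + K * `|z - v| <= r * (1 - K * `|z - v|) ->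
  ratio_le C v z r.
Proof.
move=> Kv Cv; have := Kv (- (z - v)); have := Kv (z - v); rewrite normrN.
set k := K * _ => ub lb k1 kr.
exists (1 - k); split; first by lra.
- by move: lb; congr (C _); lincomb_field z v z v.
- apply: (@cone_lincomb _ _ _ coneC convexC
    1 (r * (1 - k) - (1 + k)) _ _ _ _ _ ub Cv) => //.
    by lra.
  by lincomb_field z v z v.
Qed.

(** Iterating [T] from [z0] makes consecutive iterates close, and [T] differs from [g] by at most
    [2 t B] on [K]. *)
Lemma approx_fixed_point (K : set X) (g : X -> X) (z0 : X) (B r : R) :
  K z0 -> (forall z, K z -> K (g z)) ->
  (forall z t, K z -> 0 <= t <= 1 -> K ((1 - t) *: z + t *: z0)) ->
  (forall z, K z -> [/\ C z, psi z = 1 & `|z| <= B]) ->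
  (forall x y, K x -> K y -> ratio_le C x y r) ->
  (forall x y s, K x -> K y -> ratio_le C x y s -> ratio_le C (g x) (g y) s) ->
  forall e : R, 0 < e -> exists2 z, K z & `|z - g z| <= e.
Proof.
move=> Kz0 gK Kconv KP Kr gne e e0.
have [Cz0 z01 z0B] := KP _ Kz0.
have B0 : 0 <= B by exact: le_trans z0B.
have [a [a0 lb ub]] := Kr _ _ Kz0 Kz0.
have [a1 ra1] := ratio_le_psi psi_ge0 z01 z01 lb ub.
have r1 : 1 <= r by nra.
have r0 : 0 < r by lra.
have d0 : 0 < 4 * B + e + e by lra.
(* The denominator gives both [2 t B <= e / 2] and [t < 1], also when [B = 0]. *)
pose t := e / (4 * B + e + e).
have t0 : 0 < t by rewrite divr_gt0.
have td : t * (4 * B + e + e) = e by rewrite divfK ?gt_eqF.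
have t1 : t < 1 by rewrite ltr_pdivrMr //; lra.
clearbody t.
have t01 : 0 < t < 1 by rewrite t0.
pose k := r^-1.
have k0 : 0 < k by rewrite invr_gt0.
(* The bound [r^-1 z <= z0] is uniform on [K], so one factor [q < 1] serves all iterates. *)
have kz0 z : K z -> C (z0 - k *: z).
  move=> Kz; have [Cz z1 _] := KP _ Kz.
  have [b [b0 lb' ub']] := Kr _ _ Kz Kz0.
  have [b1 rb1] := ratio_le_psi psi_ge0 z1 z01 lb' ub'.
  apply: (@cone_lincomb _ _ _ coneC convexC 1 (b - k) _ _ _ _ _ lb' Cz) => //.
    by rewrite subr_ge0 /k -[r^-1]mul1r ler_pdivrMr // mulrC.
  by lincomb_field z z0 z z0.
pose T z := (1 - t) *: g z + t *: z0.
have TK z : K z -> K (T z).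
  by move=> Kz; apply: Kconv; [exact: gK|rewrite !ltW].
pose q := (1 - t) / (1 - t + t * k).
have tk : 0 < t * k by rewrite mulr_gt0.
have q0 : 0 <= q by rewrite divr_ge0 //; lra.
have q1 : q < 1 by rewrite ltr_pdivrMr ?mul1r; lra.
pose z n := iter n T z0.
have Kz n : K (z n) by elim: n => //= n IHn; exact: TK.
have zr n : ratio_le C (z n) (z n.+1) (1 + q ^+ n * (r - 1)).
  elim: n => [|n IHn].
    by rewrite expr0 mul1r addrC subrK; apply: Kr.
  have -> : 1 + q ^+ n.+1 * (r - 1) = 1 + q * (1 + q ^+ n * (r - 1) - 1).
    by rewrite exprS; ring.
  have [Cg g1 _] := KP _ (gK _ (Kz n)); have [_ g2 _] := KP _ (gK _ (Kz n.+1)).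
  apply: (ratio_le_average coneC convexC psi_ge0 g1 g2 Cg Cz0 (ltW k0) t01).
  - by rewrite lerDl mulr_ge0 ?exprn_ge0 // subr_ge0.
  - exact/kz0/gK.
  - exact: gne.
have q01 : 0 <= q < 1 by rewrite q0.
have e20 : 0 < e / 2 by lra.
have [n nP] := exists_expr_mul_le ((2 * N + 1) * (r - 1) * B) q01 e20.
exists (z n) => //.
have [Cz z1 zB] := KP _ (Kz n); have [_ z2 _] := KP _ (Kz n.+1).
have [_ _ gB] := KP _ (gK _ (Kz n)).
have := ratio_le_dist Cz z1 z2 (zr n).
rewrite [1 + _]addrC addrK => le1.
(* Two errors, each made at most [e / 2]: the gap between [T] and [g], and the last displacement of
   the iteration. *)
have -> : z n - g (z n) = t *: (z0 - g (z n)) - (z n.+1 - z n).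
  rewrite /z iterS -/(z n) /T; set x := z n; set y := g x.
  by lincomb_field x y z0 x.
apply: (le_trans (ler_normB _ _)); rewrite normrZ gtr0_norm //.
have le2 : `|z0 - g (z n)| <= 2 * B.
  by apply: (le_trans (ler_normB _ _)); lra.
have qn0 : 0 <= q ^+ n by rewrite exprn_ge0.
have le3 : (2 * N + 1) * (q ^+ n * (r - 1)) * `|z n| <=
    q ^+ n * ((2 * N + 1) * (r - 1) * B).
  have -> : q ^+ n * ((2 * N + 1) * (r - 1) * B) =
    (2 * N + 1) * (q ^+ n * (r - 1)) * B by ring.
  have c0 : 0 <= 2 * N + 1 by rewrite addr_ge0 // mulr_ge0.
  have c1 : 0 <= r - 1 by lra.
  by rewrite ler_wpM2l // !mulr_ge0.
have le4 : t * `|z0 - g (z n)| <= e / 2.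
  apply: (@le_trans _ _ (t * (2 * B))); first by rewrite ler_pM2l.
  by have : 0 <= t * e by [rewrite mulr_ge0 // ltW]; lra.
by lra.
Qed.

End approximate_fixed_points.

(** * Approximate fixed points close to [v] but bounded away from it *)

Section fixed_points_near_v.
Context {R : realType} {X : completeNormedModType R} {C : set X}.
Hypothesis coneC : is_cone C.
Hypothesis convexC : convex_set (C : set (convex_lmodType X)).
Context {N : R}.
Hypothesis N_ge0 : 0 <= N.
Hypothesis normalC :
  forall x y, cone_le C 0 x -> cone_le C x y -> `|x| <= N * `|y|.
Context {psi : {linear X -> R^o}}.
Hypothesis psi_ge0 : forall x, C x -> 0 <= (psi x : R).
Hypothesis closedC : closed C.
Hypothesis pointedC : C `&` (-%R @` C) = [set 0].

Lemma cone_antisym x : C x -> C (- x) -> x = 0.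
Proof.
move=> Cx CNx; have : (C `&` (-%R @` C)) x.
  by split => //; exists (- x); rewrite ?opprK.
by rewrite pointedC.
Qed.

(** Segments are geodesics: the product of the two ratios is [b / a], which is a ratio for the pair
    [v], [w]. *)
Lemma ratio_le_segment v w (a b s : R) : 0 < a -> a <= b -> 0 < s < 1 ->
  C (w - a *: v) -> C (b *: v - w) ->
  ratio_le C v ((1 - s) *: v + s *: w)
    ((1 - s + s * b) / (1 - s + s * a)) /\
  ratio_le C w ((1 - s) *: v + s *: w)
    (((1 - s) / a + s) / ((1 - s) / b + s)).
Proof.
move=> a0 ab /andP[s0 s1] lb ub.
have b0 : 0 < b by lra.
have s'0 : 0 < 1 - s by lra.
have sa0 : 0 < s * a by rewrite mulr_gt0.
have sb0 : 0 < s * b by rewrite mulr_gt0.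
have da0 : 0 < (1 - s) / a by rewrite divr_gt0.
have db0 : 0 < (1 - s) / b by rewrite divr_gt0.
split.
- have d0 : 0 < 1 - s + s * a by exact: addr_gt0.
  exists (1 - s + s * a); rewrite divfK ?(gt_eqF d0) //; split => //.
  + apply: (@cone_lincomb _ _ _ coneC convexC s 0 _ _ _ _ _ lb lb) => //; first exact: ltW.
    by lincomb_field v w v v.
  + apply: (@cone_lincomb _ _ _ coneC convexC s 0 _ _ _ _ _ ub ub) => //; first exact: ltW.
    by lincomb_field v w v v.
- have d0 : 0 < (1 - s) / b + s by exact: addr_gt0.
  exists ((1 - s) / b + s); rewrite divfK ?(gt_eqF d0) //; split => //.
  + apply: (@cone_lincomb _ _ _ coneC convexC ((1 - s) / b) 0 _ _ _ _ _ ub ub) => //; first exact: ltW.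
    by lincomb_field v w v v; rewrite gt_eqF.
  + apply: (@cone_lincomb _ _ _ coneC convexC ((1 - s) / a) 0 _ _ _ _ _ lb lb) => //; first exact: ltW.
    by lincomb_field v w v v; rewrite gt_eqF.
Qed.

Lemma approx_fixed_point_near (G : set X) (g : X -> X) (v w : X) :
  nbhs v G -> interior C v -> psi v = 1 -> interior C w -> psi w = 1 -> G w ->
  v <> w -> g v = v -> g w = w ->
  (forall z, G z -> interior C z -> psi z = 1 -> psi (g z) = 1) ->
  (forall x y s, G x -> interior C x -> psi x = 1 ->
     G y -> interior C y -> psi y = 1 -> 0 < s ->
     ratio_le C x y s -> ratio_le C (g x) (g y) s) ->
  forall e : R, 0 < e -> exists z,
    [/\ G z, interior C z, psi z = 1, z <> v
      & `|z - v| <= e /\ `|z - g z| <= e * `|z - v|].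
Proof.
move=> nG Iv v1 Iw w1 Gw vw gv gw gpsi gne e e0.
have Cv := interior_subset Iv; have Cw := interior_subset Iw.
have v0 : 0 < (psi v : R) by rewrite v1 ltr01.
have w0 : 0 < (psi w : R) by rewrite w1 ltr01.
have Gv : G v by exact: nbhs_singleton.
pose a := cone_m C w v; pose b := cone_M C w v.
have a0 : 0 < a := cone_m_gt0 coneC psi_ge0 Iw v0.
have lb : C (w - a *: v) := cone_mP psi_ge0 closedC Iw v0.
have ub : C (b *: v - w) := cone_MP coneC psi_ge0 closedC w Iv v0.
have ub' : C ((b / a * a) *: v - w) by rewrite divfK ?gt_eqF.
have [a1 b1] := ratio_le_psi psi_ge0 v1 w1 lb ub'.
rewrite divfK ?gt_eqF // in b1.
(* If [a = b], pointedness gives [w = a v], and [psi] then gives [a = 1]. *)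
have ab : a < b.
  rewrite lt_neqAle (le_trans a1 b1) andbT; apply/eqP => eab.
  have wv : w - a *: v = 0 by apply: cone_antisym; rewrite // opprB eab.
  have {}wv : w = a *: v by apply/eqP; rewrite -subr_eq0 wv.
  apply: vw; move: w1; rewrite wv linearZ /= v1.
  by rewrite [_ *: _]mulr1 => ->; rewrite scale1r.
have [d d0 dG] : exists2 d : R, 0 < d & forall z, `|z - v| <= d -> G z.
  move/nbhs_ballP: nG => [d /= d0 dG]; exists (d / 2); first by rewrite divr_gt0.
  move=> z zd; apply: dG; rewrite -ball_normE /= distrC.
  by apply: (le_lt_trans zd); lra.
have m0 : 0 < Num.min e d by rewrite lt_min e0.
have nv0 : 0 < `|v|.
  by rewrite normr_gt0; apply/eqP => v00; move: v0; rewrite v00 linear0 ltxx.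
(* As [a <= 1], [r1 - 1 <= s (b - a) / a], so [ratio_le_dist] puts the points within ratio [r1] of
   [v] at distance at most [s L] from it. *)
pose L := (2 * N + 1) * `|v| * (b - a) / a.
have L0 : 0 < L.
  by rewrite /L divr_gt0 // mulr_gt0 ?subr_gt0 // mulr_gt0 // ltr_wpDl // mulr_ge0.
pose s := Num.min 2^-1 (Num.min e d / L).
have s0 : 0 < s by rewrite lt_min invr_gt0 ltr0n divr_gt0.
have s1 : s < 1 by rewrite gt_min; apply/orP; left; lra.
have sL : s * L <= Num.min e d by rewrite -ler_pdivlMr // /s ge_min lexx orbT.
clearbody s.
have s01 : 0 < s < 1 by rewrite s0.
have [z0r1 z0r2] := ratio_le_segment a0 (ltW ab) s01 lb ub.
set r1 := (1 - s + s * b) / _ in z0r1.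
set r2 := (_ / _) in z0r2.
have b0 : 0 < b by lra.
have sa0 : 0 < 1 - s + s * a by rewrite ltr_wpDr ?mulr_ge0 ?(ltW s0) ?(ltW a0) //; lra.
have r1E : r1 * (1 - s + s * a) = 1 - s + s * b by rewrite divfK ?gt_eqF.
have r1_gt1 : 1 < r1 by rewrite ltr_pdivlMr // mul1r ltrD2l ltr_pM2l.
have r2_gt0 : 0 < r2.
  by rewrite divr_gt0 // ltr_wpDl // divr_ge0 ?(ltW a0) ?(ltW b0) //; lra.
have r12 : r1 * r2 * a = b.
  have : 0 < 1 - s + s * b by rewrite -r1E mulr_gt0 //; lra.
  have : 0 < (1 - s) / b + s by rewrite ltr_wpDl // divr_ge0 ?(ltW b0) //; lra.
  rewrite /r1 /r2 => h1 h2; field.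
  by rewrite !gt_eqF //=; lra.
have r1L : (2 * N + 1) * (r1 - 1) * `|v| <= Num.min e d.
  apply: le_trans sL.
  have : r1 - 1 <= s * (b - a) / a.
    rewrite ler_pdivlMr //.
    have : (r1 - 1) * (1 - s + s * a) = s * (b - a) by rewrite mulrBl r1E; ring.
    move=> <-; rewrite ler_pM2l ?subr_gt0 //.
    have : 0 <= (1 - s) * (1 - a) by rewrite mulr_ge0 // subr_ge0 // ltW.
    by lra.
  have c0 : 0 <= (2 * N + 1) * `|v| by rewrite mulr_ge0 // addr_ge0 // mulr_ge0.
  move=> /(ler_wpM2l c0); congr (_ <= _); rewrite /L; ring.
clearbody r1 r2.
pose K := [set z | [/\ psi z = 1, ratio_le C v z r1 & ratio_le C w z r2]].
have KP z : K z -> [/\ G z, interior C z & `|z - v| <= e].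
  move=> [z1 zr _].
  have := ratio_le_dist coneC convexC normalC psi_ge0 Cv v1 z1 zr.
  move=> /le_trans /(_ r1L); rewrite le_min => /andP[le1 le2]; split => //.
    exact: dG.
  case: zr => k [k0 zk _]; exact: (interior_ge coneC convexC Iv k0 zk).
have [k k0 kv] := interior_order_unit coneC Iv.
(* [c] solves [(1 + k c) / (1 - k c) = r1]. A point closer to [v] would have ratio below [r1] to it,
   and passing through that point would give [v], [w] a ratio below [r1 * r2 = b / a]. *)
pose c := (r1 - 1) / (k * (1 + r1)).
have c0 : 0 < c by rewrite divr_gt0 ?subr_gt0 // mulr_gt0 //; lra.
have cK z : K z -> c <= `|z - v|.
  move=> [z1 _ zr2]; rewrite leNgt; apply/negP => lec.
  have klt : k * `|z - v| * (1 + r1) < r1 - 1.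
    by move: lec; rewrite ltr_pdivlMr ?mulr_gt0 //; [lra|lra].
  have kz0 : 0 <= k * `|z - v| by rewrite mulr_ge0 // ltW.
  have k1 : k * `|z - v| < 1 by nra.
  pose r := (1 + k * `|z - v|) / (1 - k * `|z - v|).
  have k1' : 0 < 1 - k * `|z - v| by lra.
  have r0 : 0 < r by rewrite divr_gt0 //; lra.
  have rr1 : r < r1 by rewrite ltr_pdivrMr //; lra.
  have vz : ratio_le C v z r.
    apply: (dist_ratio_le coneC convexC kv Cv k1).
    by rewrite divfK // gt_eqF.
  have zw := ratio_le_sym coneC convexC r2_gt0 zr2.
  have vw' := ratio_le_trans coneC convexC (ltW r2_gt0) vz zw.
  have rr2 : 0 < r * r2 by rewrite mulr_gt0.
  have := (ratio_leP coneC convexC psi_ge0 closedC Iv Iw v0 rr2).1 vw'.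
  rewrite -/a -/b -r12 ler_pM2r // ler_pM2r //.
  by move=> /(lt_le_trans rr1); rewrite ltxx.
have r1_gt0 : 0 < r1 by lra.
(* Since [|z - v| >= c] on [K], the absolute error [e * c] becomes a relative one. Two points of [K]
   have ratio [r1 * r1], by way of [v]. *)
have [z Kz zg] : exists2 z, K z & `|z - g z| <= e * c.
  apply: (approx_fixed_point coneC convexC N_ge0 normalC psi_ge0
    (z0 := (1 - s) *: v + s *: w) (B := `|v| + e) (r := r1 * r1)).
  - split => //; rewrite linearD !linearZ /= v1 w1.
    by rewrite -[_ + _]/((1 - s) * 1 + s * 1 : R); lra.
  - move=> z Kz; have [z1 zr1 zr2] := Kz; have [Gz Iz _] := KP z Kz; split.
    + exact: gpsi.
    + by rewrite -gv; apply: gne.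
    + by rewrite -gw; apply: gne.
  - move=> z t [z1 zr1 zr2] t01; split.
    + rewrite linearD !linearZ /= z1.
      have -> : psi ((1 - s) *: v + s *: w) = 1.
        rewrite linearD !linearZ /= v1 w1.
        by rewrite -[_ + _]/((1 - s) * 1 + s * 1 : R); lra.
      by rewrite -[_ + _]/((1 - t) * 1 + t * 1 : R); lra.
    + exact: ratio_le_convex.
    + exact: ratio_le_convex.
  - move=> z Kz; have [z1 _ _] := Kz; have [_ Iz zv] := KP z Kz; split => //.
      exact: interior_subset.
    by rewrite -[z](subrK v) addrC; apply: (le_trans (ler_normD _ _)); rewrite lerD2l.
  - move=> x y [_ xr _] [_ yr _].
    apply: (ratio_le_trans coneC convexC (ltW r1_gt0) _ yr).
    exact: ratio_le_sym.
  - move=> x y t Kx Ky [m [m_gt0 lbm ubm]].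
    have [Gx Ix _] := KP x Kx; have [Gy Iy _] := KP y Ky.
    have [x1 _ _] := Kx; have [y1 _ _] := Ky.
    (* [gne] asks for [0 < t], which follows from [1 <= t * m] and [0 < m]. *)
    apply: gne => //; last by exists m.
    by have [] := ratio_le_psi psi_ge0 x1 y1 lbm ubm; nra.
  - exact: mulr_gt0.
have [Gz Iz ze] := KP z Kz; have [z1 _ _] := Kz.
exists z; split => //.
  by move=> zv; have := cK z Kz; rewrite zv subrr normr0 leNgt c0.
split => //; apply: (le_trans zg).
by rewrite ler_pM2l //; exact: cK.
Qed.

End fixed_points_near_v.

(** Let [t] be least with [x <= t v], and [u = x - h x + a v]. Then [h x <= h (t v) <= t v], so
    [x <= (t - a + K |u|) v], and minimality of [t] gives [a <= K |u|]. *)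
Lemma subhomogeneous_multiplier_le (R : realType) (X : completeNormedModType R)
    (C : set X) (psi : {linear X -> R^o}) (h : X -> X) (v : X) (K : R) :
  is_cone C -> convex_set (C : set (convex_lmodType X)) -> closed C ->
  (forall x, C x -> 0 <= (psi x : R)) -> interior C v -> psi v = 1 ->
  (forall u, C ((K * `|u|) *: v - u)) -> h 0 = 0 ->
  (forall x y, cone_le C x y -> cone_le C (h x) (h y)) ->
  (forall x (t : R), 0 <= t -> cone_le C (h (x + t *: v)) (h x + t *: v)) ->
  forall x a, psi x = 0 -> `|a| <= K * `|x - h x + a *: v|.
Proof.
move=> coneC convexC closedC psi_ge0 Iv v1 Kv h0 hmono hsub x a x0.
set u := x - h x + a *: v.
have v0 : 0 < (psi v : R) by rewrite v1 ltr01.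
(* On the kernel of [psi] the least multiplier is nonnegative, as (A5) requires of [t]. *)
have M_ge0 y : psi y = 0 -> 0 <= cone_M C y v.
  move=> y0; have : C (cone_M C y v *: v - 1 *: y).
    by rewrite scale1r; exact: (cone_MP coneC psi_ge0 closedC).
  by move=> /(cone_psi_le psi_ge0); rewrite y0 v1 mulr1 mulr0.
rewrite ler_norml; apply/andP; split.
(* [h] need not be odd, so the bound on [- a] starts from [0 <= x + t v], which gives
   [0 <= h (x + t v) <= h x + t v]. *)
- have Nx0 : psi (- x) = 0 by rewrite linearN x0 oppr0.
  set t := cone_M C (- x) v.
  have t0 : 0 <= t := M_ge0 _ Nx0.
  have tx : C (t *: v - - x) := cone_MP coneC psi_ge0 closedC (- x) Iv v0.
  have : C (h (x + t *: v) - h 0).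
    by apply: hmono; rewrite /cone_le subr0 addrC -[x in C (_ + x)]opprK.
  rewrite h0 subr0 => C1.
  have C2 := coneD coneC convexC (hsub x t t0) C1.
  have := Kv (- u); rewrite normrN => Kvu.
  have C3 := coneD coneC convexC C2 Kvu.
  have : C ((t + a + K * `|u|) *: v - - x).
    move: C3; congr (C _); move: (h (x + _)) (h x) @u Kvu => p q u _.
    set k := K * _; rewrite /u.
    by lincomb_field x q v p.
  move=> /(cone_M_min coneC psi_ge0 Iv v0); rewrite -/t; lra.
- set t := cone_M C x v.
  have t0 : 0 <= t := M_ge0 _ x0.
  have tx : C (t *: v - x) := cone_MP coneC psi_ge0 closedC x Iv v0.
  have C1 : C (h (0 + t *: v) - h x) by apply: hmono; rewrite /cone_le add0r.
  have C2 := coneD coneC convexC (hsub 0 t t0) C1.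
  have C3 := coneD coneC convexC C2 (Kv u).
  have : C ((t - a + K * `|u|) *: v - x).
    move: C3; congr (C _); rewrite h0; move: (h (0 + _)) (h x) @u => p q u.
    set k := K * _; rewrite /u add0r.
    by lincomb_field x q v p.
  move=> /(cone_M_min coneC psi_ge0 Iv v0); rewrite -/t; lra.
Qed.

(** * Uniqueness of the eigenvector from the semidifferential at [v] *)

Unset Implicit Arguments.

Theorem theorem7p5 (R : realType) (X : completeNormedModType R)
  (C : set X) (psi : {linear X -> R^o}) (G : set X)
  (f : X -> X) (v : X) (df : X -> X)
  (hC : normal_cone C) (hCint : interior C !=set0)
  (hpsi : dual_cone C psi) (hpsi0 : exists x : X, psi x <> 0)
  (hGopen : open G) (hGC : G `<=` C)
  (hf : forall x, G x -> interior C (f x))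
  (hfd : forall x y, (G `&` cone_slice C psi) x -> (G `&` cone_slice C psi) y ->
     hilbert_metric C (f x) (f y) <= hilbert_metric C x y)
  (hv : (G `&` cone_slice C psi) v) (hfv : f v = v)
  (hA1 : is_semidifferential G f v df)
  (hA2 : property_F (psi @^-1` [set 0]) (fun x => x - df x))
  (hA3 : forall x : X, psi x = 0 -> df x = x -> x = 0)
  (hA4 : forall x y : X, cone_le C x y -> cone_le C (df x) (df y))
  (hA5 : forall (x : X) (t : R), 0 <= t -> cone_le C (df (x + t *: v)) (df x + t *: v)) :
  forall (w : X) (lambda : R),
    (G `&` cone_slice C psi) w -> 0 < lambda -> f w = lambda *: w -> w = v.
Proof.
move=> w lambda hw lambda0 hfw; apply: contrapT => wv.
have [[coneC closedC convexC pointedC] [N' hN']] := hC.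
pose N := `|N'|; have N_ge0 : 0 <= N by rewrite normr_ge0.
have normalC x y : cone_le C 0 x -> cone_le C x y -> `|x| <= N * `|y|.
  move=> x0 xy; apply: (le_trans (hN' x y x0 xy)).
  by rewrite ler_wpM2r // ler_norm.
have [psic psi_ge0] := hpsi.
have psi_pos x : interior C x -> 0 < (psi x : R).
  exact: (psi_gt0 coneC psi_ge0 hpsi0).
have [Gv [Iv v1]] := hv; have [Gw [Iw w1]] := hw.
have [_ dfc dfZ dfo] := hA1.
have df0 := homogeneous0 dfZ.
have [c c0 dfC] := property_F_coercive psic dfc dfZ hA2 hA3.
have [K K0 Kv] := interior_order_unit coneC Iv.
have [Kd Kd0 dfB] := homogeneous_bounded dfZ df0 (dfc 0).
have [Kp Kp0 psiB] : exists2 Kp : R, 0 < Kp & forall x, `|psi x : R| <= Kp * `|x|.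
  apply: (@homogeneous_bounded R X R^o psi) => [t x _||].
  - by rewrite linearZ.
  - by rewrite linear0.
  - exact: psic.
pose g z := (psi (f z) : R)^-1 *: f z.
have fpos z : G z -> 0 < (psi (f z) : R) by move=> /hf /psi_pos.
(* One tolerance [tau] replaces the limits. With [y = z - v], [A |y|] will bound the eigenvalue
   defect [psi (f z) - 1] and [tau B |y|] will bound [y - df y]; then [tau B <= c / 2] contradicts
   coercivity. *)
pose A := Kp * (Kd + 1); have A0 : 0 < A by rewrite mulr_gt0 // addr_gt0.
have nv0 : 0 <= `|v| by [].
pose B := (1 + K * `|v|) * (2 + 2 * A).
have B0 : 0 < B.
  by rewrite /B mulr_gt0 // ltr_pwDl // mulr_ge0 // ltW.
pose tau := Num.min 1 (c / 2 / B).
have tau0 : 0 < tau by rewrite lt_min ltr01 !divr_gt0.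
have tau1 : tau <= 1 by rewrite ge_min lexx.
have tauB : tau * B <= c / 2 by rewrite -ler_pdivlMr // ge_min lexx orbT.
clearbody tau.
move/eqaddoP : dfo => /(_ tau tau0) /nbhs_ballP[d /= d0 dP].
(* [e <= tau] controls the residual of [g]; [e <= d / 2] puts [z - v] in the ball where the
   expansion of [f] holds. *)
pose e := Num.min tau (d / 2).
have e0 : 0 < e by rewrite lt_min tau0 divr_gt0.
have nG : nbhs v G by exact: open_nbhs_nbhs.
have [z [Gz Iz z1 zv [zve zg]]] : exists z,
    [/\ G z, interior C z, psi z = 1, z <> v
      & `|z - v| <= e /\ `|z - g z| <= e * `|z - v|].
  apply: (approx_fixed_point_near (w := w) coneC convexC N_ge0 normalC
    psi_ge0 closedC pointedC nG Iv v1 Iw w1 Gw) => //.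
  - by move=> /esym.
  - by rewrite /g hfv v1 invr1 scale1r.
  - have pw : psi (lambda *: w) = lambda by rewrite linearZ w1; exact: mulr1.
    rewrite /g hfw pw scalerA mulVf ?scale1r //.
    by rewrite gt_eqF.
  - move=> x Gx _ _; rewrite /g linearZ.
    by apply: mulVf; rewrite gt_eqF // fpos.
  - move=> x y s Gx Ix x1 Gy Iy y1 s0 xy.
    have ixy : hilbert_metric C x y <= ln s.
      by apply/(hilbert_metric_le coneC convexC psi_ge0 closedC) => //; exact: psi_pos.
    apply: ratio_leZl => //; first by rewrite invr_gt0 fpos.
    apply: ratio_leZr => //; first by rewrite invr_gt0 fpos.
    apply/(hilbert_metric_le coneC convexC psi_ge0 closedC) => //; try exact: hf.
      exact: fpos.
    by apply: le_trans ixy; apply: hfd.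
have zv_gt0 : 0 < `|z - v|.
  by rewrite normr_gt0 subr_eq0; apply/eqP.
have [etau ed] : e <= tau /\ e <= d / 2 by rewrite !ge_min !lexx orbT.
clearbody e.
pose y := z - v.
have y0 : psi y = 0 by rewrite linearB z1 v1 subrr.
have : `|f z - v - df y| <= tau * `|y|.
  have : ball 0 d y.
    rewrite -ball_normE /= sub0r normrN; apply: (le_lt_trans zve).
    by apply: (le_lt_trans ed); rewrite ltr_pdivrMr // ltr_pMr // ltr1n.
  by move=> /dP; rewrite -[(_ - _) y]/(f (y + v) - (f v + df y)) subrK hfv opprD addrA.
set eps := f z - v - df y => epsB.
pose a : R := psi (f z) - 1.
have aE : a = psi (df y) + psi eps.
  rewrite /a /eps !linearB v1.
  by rewrite -[RHS]/((psi (df y) : R) + (psi (f z) - 1 - psi (df y)));  ring.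
have aB : `|a| <= A * `|y|.
  have b1 : `|psi (df y) : R| <= Kp * (Kd * `|y|).
    by apply: (le_trans (psiB _)); rewrite ler_pM2l.
  have b2 : `|psi eps : R| <= Kp * (tau * `|y|).
    by apply: (le_trans (psiB _)); rewrite ler_pM2l.
  rewrite aE; apply: (le_trans (ler_normD _ _)); apply: (le_trans (lerD b1 b2)).
  have : 0 <= Kp * (1 - tau) * `|y| by rewrite !mulr_ge0 ?subr_ge0 // ltW.
  by rewrite /A; lra.
pose E := y - df y + a *: v.
(* The three terms, obtained from [f z = (1 + a) g z], are bounded by [tau |y|], [(1 + A) tau |y|]
   and [A tau |y|], whence the factor [2 + 2 A]. *)
have EE : E = eps + (1 + a) *: (z - g z) - a *: y.
  have fz : f z = (1 + a) *: g z.
    by rewrite /a addrC subrK scalerA mulfV ?scale1r // gt_eqF // fpos.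
  rewrite /E /eps fz /y; move: (g z) (df _) => p q.
  by lincomb_field z v p q.
have EB : `|E| <= tau * (2 + 2 * A) * `|y|.
  have aAt : `|a| <= A * tau.
    apply: (le_trans aB); rewrite ler_pM2l //.
    exact: le_trans etau.
  rewrite EE; apply: (le_trans (ler_normB _ _)).
  apply: (le_trans (lerD (ler_normD _ _) (lexx _))).
  rewrite !normrZ.
  have a1 : `|1 + a| <= 1 + A * tau.
    by apply: (le_trans (ler_normD _ _)); rewrite normr1 lerD2l.
  have zg' : `|z - g z| <= tau * `|y|.
    by apply: (le_trans zg); rewrite ler_pM2r.
  have h1 : `|1 + a| * `|z - g z| <= (1 + A) * (tau * `|y|).
    apply: ler_pM => //; apply: (le_trans a1); rewrite lerD2l.
    by rewrite -[leRHS]mulr1 ler_pM2l.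
  have h2 : `|a| * `|y| <= A * tau * `|y| by rewrite ler_wpM2r.
  by lra.
have aE' : `|a| <= K * `|E|.
  exact: (subhomogeneous_multiplier_le coneC convexC closedC psi_ge0 Iv v1 Kv
    df0 hA4 hA5).
have yE : `|y - df y| <= (1 + K * `|v|) * `|E|.
  have -> : y - df y = E - a *: v by rewrite /E addrK.
  apply: (le_trans (ler_normB _ _)); rewrite normrZ.
  have := ler_wpM2r nv0 aE'; lra.
have cB : c * `|y| <= tau * B * `|y|.
  apply: (le_trans (dfC y y0)); apply: (le_trans yE).
  have Kv0 : 0 < 1 + K * `|v| by rewrite ltr_pwDl // mulr_ge0 // ltW.
  have := EB; rewrite -(ler_pM2l Kv0) /B; lra.
move: cB; rewrite (ler_pM2r zv_gt0) => cB.
by have := le_trans cB tauB; lra.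
Qed.
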